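(* For every integer $n\geq 4$, $$\frac{n(n-2)}{(n+2)^2}<\frac{J_n(2)}{J_n(0)}\leq\frac{n-2}{n+4}.$$ This leads to the following estimate for central values: $$\frac{n}{n+1}<\frac{J_{n+2}(0)}{J_n(0)}\leq\frac{(n+2)(n^2+2n-2)}{n(n+1)(n+4)},$$ where the lower bound holds for every integer $n\geq 2$ and the upper bound holds for every integer $n\geq 4$.
   Context: For an integer $n\geq 1$ and $r\in\mathbb{R}$, the Laplace--Pólya integral is $J_n(r)=\frac{1}{\pi}\int_{-\infty}^{\infty}\operatorname{sinc}^n(t)\cos(rt)\,dt$, where $\operatorname{sinc}(x)=\frac{\sin x}{x}$ for $x\neq 0$ and $\operatorname{sinc}(0)=1$. The second estimate is derived from the first via the recursion $J_n(r)=\frac{n+r}{2(n-1)}J_{n-1}(r+1)+\frac{n-r}{2(n-1)}J_{n-1}(r-1)$ for $n\geq 3$, and its special case $J_n(0)=\frac{n}{n-1}J_{n-1}(1)$ for $n\geq 3$.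
   Formalization: The strict lower bound n/(n+1) < J_{n+2}(0)/J_n(0) fails at n = 2, where J_2(0) = 1 and J_4(0) = 2/3 give equality; the formal theorem states it as ≤ for n ≥ 2 and as strict < for n ≥ 3. *)

(* Defs.v *)
From Stdlib Require Import Reals.
From Coquelicot Require Import Coquelicot.
Open Scope R_scope.

Definition sinc (x : R) : R :=
  if Req_EM_T x 0 then 1 else sin x / x.

(* An improper Riemann integral: the two endpoints tend to -oo and +oo
   independently.  This also covers n = 1, where the integrand is not
   absolutely integrable.  Only n >= 1 is meaningful: for n = 0 the integral
   diverges and [RInt_gen] returns an unspecified value. *)
Definition laplace_polya (n : nat) (r : R) : R :=
  / PI * RInt_gen (fun t : R => sinc t ^ n * cos (r * t))
           (Rbar_locally m_infty) (Rbar_locally p_infty).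

(* Main.v *)
Require Import Defs.
From Stdlib Require Import Reals.
From Coquelicot Require Import Coquelicot.
From Stdlib Require Import Lra Lia ZArith FunctionalExtensionality.
Open Scope R_scope.

(* Up to a positive factor depending only on [n], the values of [J_n] at the
   integers are integers [B_n(z)] satisfying
     B_n(z) = (n + z) B_(n-1)(z + 1) + (n - z) B_(n-1)(z - 1).
   Hence q_n(r) = J_n(r + 2) / J_n(r) satisfies
     q_n(r) = ((n + r + 2) q_(n-1)(r + 1) + (n - r - 2))
              / ((n + r) + (n - r) / q_(n-1)(r - 1)),
   which is increasing in both values of q_(n-1); bounds valid for all integers
   r >= -1 therefore propagate by induction on [n].  With x = r + 1, the
   inductive upper bound is
     (n - x - 1)(n - x + 1)(n - x + 3) / ((n + x - 1)(n + x + 1)(n + x + 3)),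
   and the inductive lower bound is ((6n + 2 - 9x) / (6n + 2 + 9x))^2, as long as
   6n + 2 - 9x >= 0.  At x = 1 they give the bounds on J_n(2) / J_n(0), and two
   steps of the recursion turn these into bounds on J_(n+2)(0) / J_n(0).  The
   values of [J_2] only matter up to a factor: sinc^2 t cos (r t) is a combination
   of dilations of sinc^2, so the value of the integral of sinc^2 is not needed. *)

(** * Elementary properties of [sinc] *)

Lemma sinc_mul x : x * sinc x = sin x.
Proof.
  unfold sinc; destruct (Req_EM_T x 0) as [->|Hx].
  - rewrite sin_0; ring.
  - field; exact Hx.
Qed.

Lemma sinc_even x : sinc (- x) = sinc x.
Proof.
  unfold sinc; destruct (Req_EM_T (- x) 0), (Req_EM_T x 0); try lra.
  rewrite sin_neg; field; assumption.
Qed.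

Lemma sinc_0 : sinc 0 = 1.
Proof. unfold sinc; destruct (Req_EM_T 0 0); [reflexivity|lra]. Qed.

Lemma continuous_sinc x : continuous sinc x.
Proof.
  destruct (Req_EM_T x 0) as [->|Hx].
  - apply continuity_pt_filterlim, continuity_pt_locally; intros eps.
    (* Continuity at [0] is the statement that [sin] has derivative [1] there, since [sinc y] is its
       difference quotient. *)
    destruct (proj1 (is_derive_Reals sin 0 1) ltac:(rewrite <- cos_0; apply is_derive_sin) eps (cond_pos eps))
      as [d Hd].
    exists d; intros y Hy.
    rewrite sinc_0.
    unfold sinc; destruct (Req_EM_T y 0) as [->|Hy0].
    + rewrite Rminus_diag, Rabs_R0; apply cond_pos.
    + specialize (Hd y Hy0).
      rewrite Rplus_0_l, sin_0, Rminus_0_r in Hd.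
      apply Hd.
      change (Rabs (y - 0) < d) in Hy; now rewrite Rminus_0_r in Hy.
  - apply continuous_ext_loc with (fun y => sin y / y).
    + exists (mkposreal (Rabs x) (Rabs_pos_lt x Hx)); intros y Hy.
      unfold sinc; destruct (Req_EM_T y 0) as [->|]; [|reflexivity].
      change (Rabs (0 - x) < Rabs x) in Hy.
      rewrite Rabs_minus_sym, Rminus_0_r in Hy; lra.
    + apply (ex_derive_continuous (K := R_AbsRing) (V := R_NormedModule)); auto_derive; auto.
Qed.

Lemma Rabs_sinc_le_1 x : Rabs (sinc x) <= 1.
Proof.
  destruct (Req_EM_T x 0) as [->|Hx].
  { rewrite sinc_0, Rabs_R1; lra. }
  destruct (MVT_gen sin 0 x cos) as [c [_ Hc]].
  - intros; apply is_derive_sin.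
  - intros; apply continuity_sin.
  - rewrite sin_0, !Rminus_0_r in Hc.
    apply (Rmult_le_reg_l (Rabs x)); [now apply Rabs_pos_lt|].
    rewrite <- Rabs_mult, sinc_mul, Hc, Rabs_mult.
    pose proof (Rabs_pos x).
    assert (Rabs (cos c) <= 1) by (apply Rabs_le; apply COS_bound).
    nra.
Qed.

(** Two of the factors absorb [x ^ 2] and become [sin x ^ 2]; the others are at most [1] in absolute
    value. This decay makes the integrals with [n >= 2] converge absolutely. *)
Lemma pow2_mul_sinc_pow_le n x : (2 <= n)%nat -> x ^ 2 * Rabs (sinc x ^ n) <= 1.
Proof.
  intros Hn.
  destruct n as [|[|n]]; [lia|lia|].
  replace (sinc x ^ S (S n)) with ((sinc x) ^ 2 * sinc x ^ n) by (simpl; ring).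
  rewrite Rabs_mult, <- RPow_abs, <- RPow_abs, pow2_abs.
  replace (x ^ 2 * (sinc x ^ 2 * Rabs (sinc x) ^ n))
    with ((x * sinc x) ^ 2 * Rabs (sinc x) ^ n) by ring.
  rewrite sinc_mul.
  assert (0 <= Rabs (sinc x) ^ n <= 1).
  { split; [apply pow_le, Rabs_pos|].
    rewrite <- (pow1 n); apply pow_incr; split; [apply Rabs_pos|apply Rabs_sinc_le_1]. }
  assert (0 <= sin x ^ 2 <= 1).
  { pose proof (sin2_cos2 x); unfold Rsqr in *. pose proof (pow2_ge_0 (sin x)).
    pose proof (pow2_ge_0 (cos x)); nra. }
  nra.
Qed.

Lemma continuous_cos_lin r t : continuous (fun t => cos (r * t)) t.
Proof. apply (ex_derive_continuous (K := R_AbsRing) (V := R_NormedModule)); auto_derive; auto. Qed.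

Lemma continuous_sinc_pow n t : continuous (fun t => sinc t ^ n) t.
Proof.
  induction n as [|n IH]; simpl.
  - apply continuous_const.
  - apply (continuous_mult (K := R_AbsRing)); [apply continuous_sinc|exact IH].
Qed.

Lemma continuous_sinc_pow_cos n r t : continuous (fun t => sinc t ^ n * cos (r * t)) t.
Proof.
  apply (continuous_mult (K := R_AbsRing)).
  - apply continuous_sinc_pow.
  - apply continuous_cos_lin.
Qed.

(** * Convergence of improper integrals under quadratic decay *)

Lemma abs_RInt_quadratic_decay (f : R -> R) :
  (forall x, continuous f x) -> (forall x, x ^ 2 * Rabs (f x) <= 1) ->
  forall M a b, 0 < M -> (M <= a /\ M <= b) \/ (a <= - M /\ b <= - M) -> Rabs (RInt f a b) <= / M.
Proof.
  intros Hc Hb M.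
  assert (Hex : forall a b, ex_RInt f a b)
    by (intros; apply (ex_RInt_continuous (V := R_CompleteNormedModule)); auto).
  assert (Hd : forall a b, 0 < M -> a <= b -> (M <= a) \/ (b <= - M) ->
     Rabs (RInt f a b) <= / M).
  { intros a b HM Hab Hs.
    (* The comparison function is [/ x ^ 2], with antiderivative [- / x]; the interval stays on one
       side of [0]. *)
    assert (HI : is_RInt (fun x => / x ^ 2) a b (/ a - / b)).
    { replace (/ a - / b) with (minus (- / b) (- / a)) by (unfold minus, plus, opp; simpl; ring).
      apply (is_RInt_derive (V := R_CompleteNormedModule) (fun x => - / x)).
      - intros x Hx; rewrite Rmin_left, Rmax_right in Hx by lra.
        auto_derive; [destruct Hs; lra|field; destruct Hs; lra].
      - intros x Hx; rewrite Rmin_left, Rmax_right in Hx by lra.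
        apply (ex_derive_continuous (K := R_AbsRing) (V := R_NormedModule)); auto_derive.
        nra. }
    eapply Rle_trans.
    - apply (abs_RInt_le f a b Hab (Hex a b)).
    - apply Rle_trans with (/ a - / b).
      + rewrite <- (is_RInt_unique _ _ _ _ HI).
        apply RInt_le; [exact Hab| |now exists (/ a - / b)|].
        * apply (ex_RInt_continuous (V := R_CompleteNormedModule)); intros.
          apply (continuous_comp f Rabs); [apply Hc|apply continuous_Rabs].
        * intros x Hx.
          assert (0 < x ^ 2) by (destruct Hs; nra).
          apply (Rmult_le_reg_l (x ^ 2)); [assumption|].
          rewrite Rinv_r by lra; apply Hb.
      + destruct Hs as [Hs|Hs].
        * assert (0 < / b) by (apply Rinv_0_lt_compat; lra).
          assert (/ a <= / M) by (apply Rinv_le_contravar; lra). lra.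
        * assert (/ a < 0) by (apply Rinv_lt_0_compat; lra).
          assert (/ - b <= / M) by (apply Rinv_le_contravar; lra).
          rewrite Rinv_opp in *. lra. }
  intros a b HM Hs.
  destruct (Rle_dec a b).
  - apply Hd; lra.
  - rewrite <- opp_RInt_swap by apply Hex.
    change (Rabs (- RInt f b a) <= / M); rewrite Rabs_Ropp; apply Hd; lra.
Qed.

(** Cauchy criterion: the integrals over two large intervals differ by two tails, both bounded by
    the preceding estimate in whichever order their endpoints come. *)
Lemma ex_RInt_gen_quadratic_decay (f : R -> R) :
  (forall x, continuous f x) -> (forall x, x ^ 2 * Rabs (f x) <= 1) ->
  ex_RInt_gen f (Rbar_locally m_infty) (Rbar_locally p_infty).
Proof.
  intros Hc Hb.
  assert (Hex : forall a b, ex_RInt f a b)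
    by (intros; apply (ex_RInt_continuous (V := R_CompleteNormedModule)); auto).
  unfold ex_RInt_gen, is_RInt_gen.
  apply (filterlimi_locally_cauchy (U := R_CompleteSpace)).
  - apply filter_forall; intros [a b]; split.
    + destruct (Hex a b) as [l Hl]; now exists l.
    + intros y1 y2 H1 H2.
      rewrite <- (is_RInt_unique _ _ _ _ H1); now apply is_RInt_unique.
  - intros eps.
    (* Each tail is at most [/ M], a quarter of [eps]. *)
    set (M := 4 / eps).
    assert (HM : 0 < M) by (apply Rdiv_lt_0_compat; [lra|apply cond_pos]).
    exists (fun ab => fst ab < - M /\ M < snd ab); split.
    + exists (fun a => a < - M) (fun b => M < b); [now exists (- M)|now exists M|auto].
    + intros [a b] [a' b'] [Ha Hb1] [Ha' Hb'] l l' Hl Hl'; simpl in *.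
      apply (is_RInt_unique (V := R_CompleteNormedModule)) in Hl, Hl'; subst l l'.
      change (Rabs (RInt f a' b' - RInt f a b) < eps).
      assert (E1 := RInt_Chasles f a' a b' (Hex _ _) (Hex _ _)).
      assert (E2 := RInt_Chasles f a b b' (Hex _ _) (Hex _ _)).
      unfold plus in E1, E2; simpl in E1, E2.
      rewrite <- E1, <- E2.
      replace (RInt f a' a + (RInt f a b + RInt f b b') - RInt f a b)
        with (RInt f a' a + RInt f b b') by ring.
      eapply Rle_lt_trans; [apply Rabs_triang|].
      assert (Rabs (RInt f a' a) <= / M) by (apply abs_RInt_quadratic_decay; auto; lra).
      assert (Rabs (RInt f b b') <= / M) by (apply abs_RInt_quadratic_decay; auto; lra).
      assert (/ M = eps / 4) by (unfold M; field; apply Rgt_not_eq, cond_pos).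
      pose proof (cond_pos eps); lra.
Qed.

(** * The integrals without the factor [/ PI], and their recursion by integration by parts *)

Definition polya_integral (n : nat) (r : R) : R :=
  RInt_gen (fun t : R => sinc t ^ n * cos (r * t)) (Rbar_locally m_infty) (Rbar_locally p_infty).

Lemma is_polya_integral n r : (2 <= n)%nat ->
  is_RInt_gen (fun t => sinc t ^ n * cos (r * t))
    (Rbar_locally m_infty) (Rbar_locally p_infty) (polya_integral n r).
Proof.
  intros Hn.
  apply (RInt_gen_correct (V := R_CompleteNormedModule)).
  apply ex_RInt_gen_quadratic_decay.
  - apply continuous_sinc_pow_cos.
  - intros x. rewrite Rabs_mult.
    pose proof (pow2_mul_sinc_pow_le n x Hn).
    assert (Rabs (cos (r * x)) <= 1) by (apply Rabs_le; apply COS_bound).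
    pose proof (Rabs_pos (cos (r * x))). pose proof (Rabs_pos (sinc x ^ n)).
    pose proof (pow2_ge_0 x).
    assert (0 <= x ^ 2 * Rabs (sinc x ^ n)) by (apply Rmult_le_pos; lra).
    nra.
Qed.

Lemma is_RInt_gen_lin a b (f g : R -> R) lf lg :
  is_RInt_gen f (Rbar_locally m_infty) (Rbar_locally p_infty) lf ->
  is_RInt_gen g (Rbar_locally m_infty) (Rbar_locally p_infty) lg ->
  is_RInt_gen (fun t => a * f t + b * g t)
    (Rbar_locally m_infty) (Rbar_locally p_infty) (a * lf + b * lg).
Proof.
  intros Hf Hg.
  exact (is_RInt_gen_plus _ _ _ _ (is_RInt_gen_scal _ a _ Hf) (is_RInt_gen_scal _ b _ Hg)).
Qed.

Lemma polya_integral_even n r : polya_integral n (- r) = polya_integral n r.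
Proof.
  unfold polya_integral; f_equal.
  apply functional_extensionality; intros t.
  rewrite Ropp_mult_distr_l_reverse, cos_neg; reflexivity.
Qed.

(** The difference quotient at [0] is [g h] itself, so continuity of [g] suffices. This settles the
    point [0] below without differentiating [sinc] there. *)
Lemma is_derive_id_mul_continuous (g : R -> R) :
  continuous g 0 -> is_derive (fun t => t * g t) 0 (g 0).
Proof.
  intros Hg; apply is_derive_Reals; intros eps Heps.
  apply continuity_pt_filterlim in Hg.
  pose proof (proj1 (continuity_pt_locally g 0) Hg) as Hg0; clear Hg.
  destruct (Hg0 (mkposreal eps Heps)) as [d Hd].
  exists d; intros h Hh Hhd.
  replace (((0 + h) * g (0 + h) - 0 * g 0) / h) with (g h)
    by (rewrite Rplus_0_l; field; exact Hh).
  apply Hd. change (Rabs (h - 0) < d). now rewrite Rminus_0_r.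
Qed.

(** Away from [0] the function is [sin t ^ (n + 1) * cos (r * t) / t ^ n]. The power of [t] yields
    the term with [- INR n]; the other two derivatives give [sinc t ^ n] times products of [cos t],
    [sin t] with [cos (r * t)], [sin (r * t)], which the addition formulas turn into frequencies
    [r + 1] and [r - 1]. *)
Lemma is_derive_id_mul_sinc_pow_cos n r t :
  is_derive (fun t => t * (sinc t ^ S n * cos (r * t))) t
    (- INR n * (sinc t ^ S n * cos (r * t))
     + ((INR (S n) + r) / 2 * (sinc t ^ n * cos ((r + 1) * t))
        + (INR (S n) - r) / 2 * (sinc t ^ n * cos ((r - 1) * t)))).
Proof.
  rewrite S_INR.
  replace (((r + 1) * t)) with (r * t + t) by ring.
  replace (((r - 1) * t)) with (r * t - t) by ring.
  rewrite cos_plus, cos_minus.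
  destruct (Req_EM_T t 0) as [->|Ht].
  - replace (- INR n * (sinc 0 ^ S n * cos (r * 0)) + _) with (sinc 0 ^ S n * cos (r * 0)).
    + apply (is_derive_id_mul_continuous (fun t => sinc t ^ S n * cos (r * t))).
      apply continuous_sinc_pow_cos.
    + rewrite sinc_0, !pow1, Rmult_0_r, cos_0, sin_0; field.
  - apply is_derive_ext_loc with (fun t => t * ((sin t / t) ^ S n * cos (r * t))).
    + exists (mkposreal (Rabs t) (Rabs_pos_lt t Ht)); intros y Hy.
      unfold sinc; destruct (Req_EM_T y 0) as [->|]; [|reflexivity].
      change (Rabs (0 - t) < Rabs t) in Hy.
      rewrite Rabs_minus_sym, Rminus_0_r in Hy; lra.
    + auto_derive; [exact Ht|].
      unfold sinc; destruct (Req_EM_T t 0) as [|_]; [contradiction|].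
      change (match n with 0%nat => 1 | S _ => INR n + 1 end) with (INR (S n)).
      rewrite S_INR. simpl pred. rewrite <- !tech_pow_Rmult.
      unfold Rdiv; rewrite <- ?tech_pow_Rmult.
      field; exact Ht.
Qed.

(** Two factors [sinc] bound the boundary term by [1 / |t|]. A general filter lets one proof serve
    both ends of the line. *)
Lemma filterlim_id_mul_sinc_pow_cos (F : (R -> Prop) -> Prop) {HF : Filter F} n r :
  (forall M, F (fun t => M < Rabs t)) ->
  filterlim (fun t => t * (sinc t ^ S (S n) * cos (r * t))) F (locally 0).
Proof.
  intros Habs P [eps HP].
  unfold filtermap.
  apply filter_imp with (2 := Habs (/ eps)).
  intros t Ht; apply HP.
  set (y := t * _).
  change (Rabs (y - 0) < eps); rewrite Rminus_0_r; unfold y.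
  pose proof (cond_pos eps) as He.
  assert (0 < / eps) by now apply Rinv_0_lt_compat.
  apply (Rmult_lt_reg_l (Rabs t)); [lra|].
  rewrite !Rabs_mult, <- Rmult_assoc.
  replace (Rabs t * Rabs t) with (t ^ 2) by (rewrite <- Rabs_mult, Rabs_pos_eq; [ring|apply Rle_0_sqr]).
  pose proof (pow2_mul_sinc_pow_le (S (S n)) t ltac:(lia)).
  assert (Rabs (cos (r * t)) <= 1) by (apply Rabs_le; apply COS_bound).
  pose proof (Rabs_pos (cos (r * t))).
  assert (0 <= t ^ 2 * Rabs (sinc t ^ S (S n)))
    by (apply Rmult_le_pos; [apply pow2_ge_0|apply Rabs_pos]).
  apply Rle_lt_trans with 1.
  - rewrite <- Rmult_assoc. nra.
  - apply (Rmult_lt_reg_r (/ eps)); [assumption|].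
    rewrite Rmult_assoc, Rinv_r by lra; lra.
Qed.

(** The derivative of [t * (sinc t ^ (n + 1) * cos (r * t))] has integral [0 - 0] over the line, and
    its three terms are the three integrals. *)
Lemma polya_integral_rec n r : (2 <= n)%nat ->
  INR n * polya_integral (S n) r
  = (INR (S n) + r) / 2 * polya_integral n (r + 1)
    + (INR (S n) - r) / 2 * polya_integral n (r - 1).
Proof.
  intros Hn.
  destruct n as [|n]; [lia|].
  set (F := fun t => t * (sinc t ^ S (S n) * cos (r * t))).
  assert (HD : is_RInt_gen (Derive F) (Rbar_locally m_infty) (Rbar_locally p_infty) (0 - 0)).
  { assert (HF := is_derive_id_mul_sinc_pow_cos (S n) r).
    apply is_RInt_gen_Derive.
    - apply filter_forall; intros ab x _. eexists; apply HF.
    - apply filter_forall; intros ab x _.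
      eapply continuous_ext; [intros y; symmetry; apply is_derive_unique, HF|].
      apply (continuous_plus (V := R_NormedModule));
        [|apply (continuous_plus (V := R_NormedModule))];
        apply (continuous_scal_r (V := R_NormedModule)); apply continuous_sinc_pow_cos.
    - apply filterlim_id_mul_sinc_pow_cos; [apply _|].
      intros M; exists (- Rabs M); intros x Hx.
      rewrite Rabs_left; [pose proof (Rle_abs M); lra|pose proof (Rabs_pos M); lra].
    - apply filterlim_id_mul_sinc_pow_cos; [apply _|].
      intros M; exists (Rabs M); intros x Hx.
      rewrite Rabs_pos_eq; [pose proof (Rle_abs M); lra|pose proof (Rabs_pos M); lra]. }
  assert (HE := is_RInt_gen_lin (- INR (S n)) 1 _ _ _ _
    (is_polya_integral (S (S n)) r ltac:(lia))
    (is_RInt_gen_lin ((INR (S (S n)) + r) / 2) ((INR (S (S n)) - r) / 2) _ _ _ _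
      (is_polya_integral (S n) (r + 1) Hn) (is_polya_integral (S n) (r - 1) Hn))).
  apply (is_RInt_gen_unique (V := R_CompleteNormedModule)) in HE.
  apply (is_RInt_gen_unique (V := R_CompleteNormedModule)) in HD.
  assert (E : - INR (S n) * polya_integral (S (S n)) r
    + 1 * ((INR (S (S n)) + r) / 2 * polya_integral (S n) (r + 1)
       + (INR (S (S n)) - r) / 2 * polya_integral (S n) (r - 1)) = 0 - 0).
  { etransitivity; [symmetry; exact HE|rewrite <- HD].
    f_equal. apply functional_extensionality; intros t.
    rewrite Rmult_1_l; symmetry; apply is_derive_unique, is_derive_id_mul_sinc_pow_cos. }
  lra.
Qed.

(** * The integrals with [n = 2] *)

Lemma is_RInt_gen_ext_all (f g : R -> R) l :
  (forall t, f t = g t) ->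
  is_RInt_gen f (Rbar_locally m_infty) (Rbar_locally p_infty) l ->
  is_RInt_gen g (Rbar_locally m_infty) (Rbar_locally p_infty) l.
Proof.
  intros Hfg; apply is_RInt_gen_ext.
  apply filter_forall; intros ab t _; apply Hfg.
Qed.

Lemma is_RInt_gen_dilate (f : R -> R) k l : 0 < k ->
  is_RInt_gen f (Rbar_locally m_infty) (Rbar_locally p_infty) l ->
  is_RInt_gen (fun t => k * f (k * t)) (Rbar_locally m_infty) (Rbar_locally p_infty) l.
Proof.
  intros Hk Hf P HP.
  destruct (Hf P HP) as [Q R' [M1 HQ] [M2 HR] H].
  exists (fun a => Q (k * a)) (fun b => R' (k * b)).
  - exists (M1 / k); intros x Hx; apply HQ.
    apply (Rmult_lt_compat_l k) in Hx; [|exact Hk].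
    replace (k * (M1 / k)) with M1 in Hx by (field; lra); exact Hx.
  - exists (M2 / k); intros x Hx; apply HR.
    apply (Rmult_lt_compat_l k) in Hx; [|exact Hk].
    replace (k * (M2 / k)) with M2 in Hx by (field; lra); exact Hx.
  - intros a b Ha Hb; destruct (H _ _ Ha Hb) as [y [Hy Py]].
    exists y; split; [|exact Py]; simpl in *.
    rewrite <- (Rplus_0_r (k * a)), <- (Rplus_0_r (k * b)) in Hy.
    apply (is_RInt_comp_lin (V := R_NormedModule)) in Hy.
    eapply is_RInt_ext; [|exact Hy].
    intros x _; simpl; now rewrite Rplus_0_r.
Qed.

(** The integrand is [(1 - cos (a * t)) / t ^ 2], written so that it makes sense at [t = 0].
    Substitution gives the factor [a] for positive [a], and evenness turns it into [Rabs a]. *)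
Lemma is_RInt_gen_sinc_sq_dilate (a : R) :
  is_RInt_gen (fun t => a ^ 2 / 2 * sinc (a / 2 * t) ^ 2)
    (Rbar_locally m_infty) (Rbar_locally p_infty) (Rabs a * polya_integral 2 0).
Proof.
  assert (H0 := is_polya_integral 2 0 ltac:(lia)).
  assert (Hpos : forall b, 0 < b ->
    is_RInt_gen (fun t => b ^ 2 / 2 * sinc (b / 2 * t) ^ 2)
      (Rbar_locally m_infty) (Rbar_locally p_infty) (b * polya_integral 2 0)).
  { intros b Hb.
    assert (H := is_RInt_gen_dilate _ (b / 2) _ ltac:(lra) H0).
    assert (H' := is_RInt_gen_lin b 0 _ _ _ _ H H).
    cbv beta in H'.
    replace (b * polya_integral 2 0) with (b * polya_integral 2 0 + 0 * polya_integral 2 0) by ring.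
    eapply is_RInt_gen_ext_all; [|exact H'].
    intros t; cbv beta.
    rewrite Rmult_0_l, cos_0; field. }
  destruct (Rtotal_order a 0) as [Ha|[->|Ha]].
  - rewrite Rabs_left by exact Ha.
    eapply is_RInt_gen_ext_all; [|exact (Hpos (- a) ltac:(lra))].
    intros t; cbv beta.
    replace (- a / 2 * t) with (- (a / 2 * t)) by field.
    rewrite sinc_even; field.
  - rewrite Rabs_R0, Rmult_0_l.
    assert (H' := is_RInt_gen_lin 0 0 _ _ _ _ H0 H0).
    rewrite !Rmult_0_l, Rplus_0_r in H'.
    eapply is_RInt_gen_ext_all; [|exact H'].
    intros t; cbv beta; field.
  - rewrite Rabs_pos_eq by lra; exact (Hpos a Ha).
Qed.

(** Expand [sin t ^ 2 * cos (r * t)] into cosines of frequencies [r], [r + 2], [r - 2]. The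
    coefficients [-1/2], [1/4], [1/4] sum to zero, so each cosine may be replaced by [1] minus it,
    with the opposite sign. *)
Lemma sinc_sq_cos r t :
  sinc t ^ 2 * cos (r * t)
  = - (1 / 2) * (r ^ 2 / 2 * sinc (r / 2 * t) ^ 2)
    + 1 * (1 / 4 * ((r + 2) ^ 2 / 2 * sinc ((r + 2) / 2 * t) ^ 2)
    + 1 / 4 * ((r - 2) ^ 2 / 2 * sinc ((r - 2) / 2 * t) ^ 2)).
Proof.
  destruct (Req_EM_T t 0) as [->|Ht].
  { rewrite !Rmult_0_r, cos_0, sinc_0; field. }
  assert (Hs : forall a, a ^ 2 / 2 * sinc (a / 2 * t) ^ 2 = (1 - cos (a * t)) / t ^ 2).
  { intros a.
    replace (a * t) with (2 * (a / 2 * t)) by field.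
    rewrite cos_2a_sin, <- sinc_mul; field; exact Ht. }
  rewrite !Hs.
  replace ((r + 2) * t) with (r * t + 2 * t) by ring.
  replace ((r - 2) * t) with (r * t - 2 * t) by ring.
  rewrite cos_plus, cos_minus, cos_2a_sin, <- sinc_mul.
  field; exact Ht.
Qed.

(** The factor is a second difference of the absolute value, that is, the tent
    [max(0, 1 - |r| / 2)]. *)
Lemma polya_integral_2 r :
  polya_integral 2 r
  = (Rabs (r + 2) / 4 + Rabs (r - 2) / 4 - Rabs r / 2) * polya_integral 2 0.
Proof.
  unfold polya_integral at 1.
  apply (is_RInt_gen_unique (V := R_CompleteNormedModule)).
  assert (H := is_RInt_gen_lin (- (1 / 2)) 1 _ _ _ _ (is_RInt_gen_sinc_sq_dilate r)
    (is_RInt_gen_lin (1 / 4) (1 / 4) _ _ _ _ (is_RInt_gen_sinc_sq_dilate (r + 2))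
       (is_RInt_gen_sinc_sq_dilate (r - 2)))).
  cbv beta in H.
  replace (_ * polya_integral 2 0) with
    (- (1 / 2) * (Rabs r * polya_integral 2 0) +
       1 * (1 / 4 * (Rabs (r + 2) * polya_integral 2 0) +
            1 / 4 * (Rabs (r - 2) * polya_integral 2 0))) by field.
  eapply is_RInt_gen_ext_all; [|exact H].
  intros t; cbv beta; symmetry; apply sinc_sq_cos.
Qed.

Lemma polya_integral_2_0_pos : 0 < polya_integral 2 0.
Proof.
  set (f := fun t => sinc t ^ 2 * cos (0 * t)).
  assert (Hc : forall x, continuous f x) by apply continuous_sinc_pow_cos.
  assert (Hex : forall a b, ex_RInt f a b)
    by (intros; apply (ex_RInt_continuous (V := R_CompleteNormedModule)); auto).
  assert (Hf : forall x, 0 <= f x).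
  { intros x; unfold f; rewrite Rmult_0_l, cos_0, Rmult_1_r; apply pow2_ge_0. }
  assert (H0 : 0 < RInt f 0 1).
  { apply RInt_gt_0; [lra| |auto].
    intros x Hx; unfold f; rewrite Rmult_0_l, cos_0, Rmult_1_r.
    apply pow2_gt_0; intros Hs.
    assert (0 < sin x) by (apply sin_gt_0; pose proof PI2_1; pose proof PI_RGT_0; lra).
    rewrite <- sinc_mul, Hs in *; lra. }
  apply Rlt_le_trans with (1 := H0).
  apply Rnot_lt_le; intros Hlt.
  assert (HI := is_polya_integral 2 0 ltac:(lia)).
  destruct (HI (fun y => y < RInt f 0 1)) as [Q R' [M1 HQ] [M2 HR] H].
  { exists (mkposreal _ (proj2 (Rlt_0_minus _ _) Hlt)); intros y Hy.
    change (Rabs (y - polya_integral 2 0) < RInt f 0 1 - polya_integral 2 0) in Hy.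
    apply Rabs_def2 in Hy; lra. }
  (* The endpoints lie far enough out for the limit and enclose [[0, 1]]; as the integrand is
     nonnegative, the integral between them is at least [RInt f 0 1]. *)
  destruct (H (Rmin M1 0 - 1) (Rmax M2 1 + 1)) as [y [Hy Hy1]].
  { apply HQ; pose proof (Rmin_l M1 0); lra. }
  { apply HR; pose proof (Rmax_l M2 1); lra. }
  simpl fst in Hy; simpl snd in Hy.
  apply (is_RInt_unique (V := R_CompleteNormedModule)) in Hy.
  pose proof (Rmin_r M1 0); pose proof (Rmax_r M2 1).
  set (a := Rmin M1 0 - 1) in *; set (b := Rmax M2 1 + 1) in *.
  change (RInt f a b = y) in Hy.
  assert (E1 := RInt_Chasles f a 0 b (Hex _ _) (Hex _ _)).
  assert (E2 := RInt_Chasles f 0 1 b (Hex _ _) (Hex _ _)).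
  unfold plus in E1, E2; simpl in E1, E2.
  assert (0 <= RInt f a 0) by (apply RInt_ge_0; auto; unfold a; lra).
  assert (0 <= RInt f 1 b) by (apply RInt_ge_0; auto; unfold b; lra).
  lra.
Qed.

(** * Integer values proportional to the integrals *)

Open Scope Z_scope.

(* [polya_num m z] is 2^(m+1) (m+1)! J_(m+2)(z). *)
Fixpoint polya_num (m : nat) (z : Z) : Z :=
  match m with
  | O => Z.max 0 (2 - Z.abs z)
  | S m' => (Z.of_nat m' + 3 + z) * polya_num m' (z + 1)
            + (Z.of_nat m' + 3 - z) * polya_num m' (z - 1)
  end.

Lemma polya_num_even m z : polya_num m (- z) = polya_num m z.
Proof.
  revert z; induction m as [|m IH]; intros z; cbn [polya_num].
  - now rewrite Z.abs_opp.
  - replace (- z + 1) with (- (z - 1)) by ring.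
    replace (- z - 1) with (- (z + 1)) by ring.
    rewrite !IH; ring.
Qed.

Lemma polya_num_support m z : Z.of_nat m + 2 <= z -> polya_num m z = 0.
Proof.
  revert z; induction m as [|m IH]; intros z Hz; cbn [polya_num].
  - lia.
  - rewrite (IH (z + 1)) by lia.
    destruct (Z.eq_dec z (Z.of_nat m + 3)) as [->|Hne].
    + ring.
    + rewrite (IH (z - 1)) by lia; ring.
Qed.

(** A weight of the recursion becomes negative only outside the support, where the value is zero. *)
Lemma polya_num_nonneg m z : 0 <= polya_num m z.
Proof.
  revert z; induction m as [|m IH]; intros z.
  - cbn [polya_num]; lia.
  - destruct (Z_le_gt_dec (Z.of_nat (S m) + 2) (Z.abs z)) as [Ho|Hi].
    + destruct (Z.abs_eq_or_opp z) as [E|E].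
      * rewrite polya_num_support; lia.
      * rewrite <- polya_num_even, polya_num_support; lia.
    + cbn [polya_num].
      pose proof (IH (z + 1)); pose proof (IH (z - 1)).
      apply Z.add_nonneg_nonneg; apply Z.mul_nonneg_nonneg; lia.
Qed.

(** Inside the support, the neighbour of [z] on the side of the origin has a positive value and a
    positive weight. *)
Lemma polya_num_pos m z : Z.abs z < Z.of_nat m + 2 -> 0 < polya_num m z.
Proof.
  revert z; induction m as [|m IH]; intros z Hz; cbn [polya_num].
  - lia.
  - pose proof (polya_num_nonneg m (z + 1)); pose proof (polya_num_nonneg m (z - 1)).
    destruct (Z_le_gt_dec 0 z).
    + assert (0 < polya_num m (z - 1)) by (apply IH; lia).
      assert (0 < (Z.of_nat m + 3 - z) * polya_num m (z - 1)) by (apply Z.mul_pos_pos; lia).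
      assert (0 <= (Z.of_nat m + 3 + z) * polya_num m (z + 1)) by (apply Z.mul_nonneg_nonneg; lia).
      lia.
    + assert (0 < polya_num m (z + 1)) by (apply IH; lia).
      assert (0 < (Z.of_nat m + 3 + z) * polya_num m (z + 1)) by (apply Z.mul_pos_pos; lia).
      assert (0 <= (Z.of_nat m + 3 - z) * polya_num m (z - 1)) by (apply Z.mul_nonneg_nonneg; lia).
      lia.
Qed.

(** * Inductive bounds on the ratios of values two apart *)

Lemma polya_num_ratio_upper m x :
  (2 <= m)%nat -> 0 <= x <= Z.of_nat m + 1 ->
  let n := Z.of_nat m + 2 in
  polya_num m (x + 1) * ((n + x - 1) * (n + x + 1) * (n + x + 3))
  <= polya_num m (x - 1) * ((n - x - 1) * (n - x + 1) * (n - x + 3)).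
Proof.
  intros Hm; revert x; induction Hm as [|m Hm IH]; intros x Hx n.
  - assert (x = 0 \/ x = 1 \/ x = 2 \/ x = 3) as [-> | [-> | [-> | ->]]] by lia;
      vm_compute; discriminate.
  (* Three values of [x] stand apart: at [0] evenness gives equality; at [n - 1] both sides vanish;
     at [n - 2] the hypothesis at [x + 1] is out of range, but the value at [x + 2] is zero. *)
  - destruct (Z.eq_dec x 0) as [->|Hx0].
    { change (0 - 1) with (- (1)); change (0 + 1) with 1.
      rewrite polya_num_even.
      replace ((n - 0 - 1) * (n - 0 + 1) * (n - 0 + 3))
        with ((n + 0 - 1) * (n + 0 + 1) * (n + 0 + 3)) by ring.
      lia. }
    destruct (Z.eq_dec x (n - 1)) as [->|Hx1].
    { rewrite polya_num_support by lia.
      replace (n - (n - 1) - 1) with 0 by ring. lia. }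
    cbn [polya_num].
    replace (x + 1 - 1) with x by ring.
    replace (x - 1 + 1) with x by ring.
    replace (x + 1 + 1) with (x + 2) by ring.
    replace (x - 1 - 1) with (x - 2) by ring.
    assert (Hn : Z.of_nat m = n - 3) by lia.
    pose proof (polya_num_nonneg m (x + 2)) as HZ.
    pose proof (polya_num_nonneg m x) as HY.
    pose proof (polya_num_nonneg m (x - 2)) as HX.
    pose proof (IH (x - 1) ltac:(lia)) as H1.
    cbv zeta in H1.
    replace (x - 1 + 1) with x in H1 by ring.
    replace (x - 1 - 1) with (x - 2) in H1 by ring.
    destruct (Z.eq_dec x (n - 2)) as [Hx2|Hx2].
    + rewrite (polya_num_support m (x + 2)) by lia.
      rewrite Hn in *. clearbody n.
      set (Y := polya_num m x) in *; set (X := polya_num m (x - 2)) in *;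
        clearbody X Y.
      subst x.
      (* This is what remains after three times [H1] is used; the quadratic is positive from [n = 5]
         on. *)
      assert (Hp : 0 <= Y * ((2 * n - 3) * (8 * n * n - 36 * n + 31)))
        by (apply Z.mul_nonneg_nonneg; [lia | nia]).
      lia.
    + pose proof (IH (x + 1) ltac:(lia)) as H2.
      cbv zeta in H2.
      replace (x + 1 + 1) with (x + 2) in H2 by ring.
      replace (x + 1 - 1) with x in H2 by ring.
      rewrite Hn in *.
      set (Y := polya_num m x) in *; set (X := polya_num m (x - 2)) in *;
      set (Zz := polya_num m (x + 2)) in *; clearbody X Y Zz n.
      (* The multipliers are the recursion weights of [Zz] and [X]. The combination leaves a slack
         of 16 times [Y * ((x - 1) * x * (x + 1))]. *)
      apply (Z.mul_le_mono_nonneg_l _ _ (n + x + 1)) in H2; [|lia].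
      apply (Z.mul_le_mono_nonneg_l _ _ (n - x + 1)) in H1; [|lia].
      assert (Hp : 0 <= Y * ((x - 1) * x * (x + 1)))
        by (apply Z.mul_nonneg_nonneg; [lia | repeat apply Z.mul_nonneg_nonneg; lia]).
      lia.
Qed.

(* In terms of [y = x - 1] and [a = u - 15] all coefficients are nonnegative. *)
Lemma ratio_lower_step w x u v :
  1 <= x -> u = w + 2 - 9 * x -> v = w + 2 + 9 * x -> 15 <= u ->
  0 <= v ^ 2 * (u + 3) ^ 2 * ((w + 6 * x + 6) * (u - 15) ^ 2 + (w - 6 * x - 6) * (v + 3) ^ 2)
       - u ^ 2 * (v + 3) ^ 2 * ((w + 6 * x - 6) * (u + 3) ^ 2 + (w - 6 * x + 6) * (v - 15) ^ 2).
Proof.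
  intros Hx Eu Ev Hu.
  remember (x - 1) as y eqn:Ey; remember (u - 15) as a eqn:Ea.
  assert (E1 : x = y + 1) by lia; assert (E2 : w = a + 9 * y + 22) by lia.
  assert (E3 : u = a + 15) by lia; assert (E4 : v = a + 18 * y + 33) by lia.
  assert (Ha : 0 <= a) by lia; assert (Hy : 0 <= y) by lia.
  clear Eu Ev Ey Ea Hu Hx; subst w x u v.
  match goal with |- 0 <= ?e => replace e with (
  216 * a ^ 4 * y + 216 * a ^ 4 + 11664 * a ^ 3 * y ^ 3 +
  42768 * a ^ 3 * y ^ 2 + 82944 * a ^ 3 * y + 51840 * a ^ 3 +
  314928 * a ^ 2 * y ^ 4 + 1697112 * a ^ 2 * y ^ 3 +
  4076568 * a ^ 2 * y ^ 2 + 5633712 * a ^ 2 * y +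
  2939328 * a ^ 2 + 1889568 * a * y ^ 5 + 16061328 * a * y ^ 4 +
  53012880 * a * y ^ 3 + 105185952 * a * y ^ 2 + 126811008 * a * y +
  60466176 * a + 31177872 * y ^ 5 + 177619392 * y ^ 4 +
  461999376 * y ^ 3 + 818182944 * y ^ 2 + 918330048 * y + 415704960) by ring end.
  repeat apply Z.add_nonneg_nonneg;
    repeat apply Z.mul_nonneg_nonneg;
    first [assumption | apply Z.pow_nonneg; assumption | discriminate].
Qed.

(** The counterpart of the previous inequality without the contribution of [x + 1]. For each of the
    15 values of [u] it becomes a polynomial in [y = x - 3] with nonnegative coefficients. *)
Lemma ratio_lower_step_edge w x u v :
  3 <= x -> u = w + 2 - 9 * x -> v = w + 2 + 9 * x -> 0 <= u <= 14 ->
  0 <= v ^ 2 * (u + 3) ^ 2 * (w - 6 * x - 6)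
       - u ^ 2 * ((w + 6 * x - 6) * (u + 3) ^ 2 + (w - 6 * x + 6) * (v - 15) ^ 2).
Proof.
  intros Hx Eu Ev Hu.
  remember (x - 3) as y eqn:Ey.
  assert (E1 : x = y + 3) by lia; assert (E2 : w = u + 9 * y + 25) by lia.
  assert (E4 : v = u + 18 * y + 54) by lia.
  assert (Hy : 0 <= y) by lia.
  clear Eu Ev Ey Hx; subst w x v.
  assert (u = 0 \/ u = 1 \/ u = 2 \/ u = 3 \/ u = 4 \/ u = 5 \/ u = 6 \/ u = 7
          \/ u = 8 \/ u = 9 \/ u = 10 \/ u = 11 \/ u = 12 \/ u = 13 \/ u = 14)
    as Hcase by lia.
  clear Hu.
  repeat (destruct Hcase as [->|Hcase]); try subst u;
    (match goal with |- 0 <= ?e => ring_simplify e end;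
     repeat apply Z.add_nonneg_nonneg;
     repeat apply Z.mul_nonneg_nonneg;
     first [assumption | apply Z.pow_nonneg; assumption | discriminate]).
Qed.

(* For [u < 15] the lower bound is not available at [x + 1], and [0 <= W]
   suffices instead. *)
Lemma ratio_lower_combine n x u v X Y W :
  1 <= x -> u = 6 * n + 2 - 9 * x -> v = 6 * n + 2 + 9 * x ->
  0 <= u -> (u < 15 -> 3 <= x) -> 0 <= Y -> 0 <= W ->
  X * (u + 3) ^ 2 <= Y * (v - 15) ^ 2 ->
  (15 <= u -> Y * (u - 15) ^ 2 <= W * (v + 3) ^ 2) ->
  ((n + (x - 1)) * Y + (n - (x - 1)) * X) * u ^ 2
  <= ((n + (x + 1)) * W + (n - (x + 1)) * Y) * v ^ 2.
Proof.
  intros Hx Eu Ev Hu Hsmall HY HW H1 H2.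
  assert (Hu3 : 0 < (u + 3) ^ 2) by (apply Z.pow_pos_nonneg; lia).
  assert (Hv3 : 0 < (v + 3) ^ 2) by (apply Z.pow_pos_nonneg; lia).
  assert (Hu2 : 0 <= u ^ 2) by (apply Z.pow_nonneg; lia).
  assert (Hv2 : 0 <= v ^ 2) by (apply Z.pow_nonneg; lia).
  assert (Hn1 : 0 <= n - x + 1) by lia.
  assert (Hn2 : 0 <= n + x + 1) by lia.
  apply Z.le_0_sub in H1; apply Z.le_0_sub.
  destruct (Z_le_gt_dec 15 u) as [Hbig|Hlt].
  - pose proof (ratio_lower_step (6 * n) x u v Hx Eu Ev Hbig) as HP.
    specialize (H2 Hbig); apply Z.le_0_sub in H2.
    clear Eu Ev Hsmall.
    (* Clearing denominators writes the difference as [Y] times the polynomial of [ratio_lower_step]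
       plus nonnegative multiples of the slacks in [H1] and [H2]. The 6 appears because that
       polynomial is stated in [w = 6 * n]. *)
    apply (Z.mul_nonneg_cancel_l (6 * ((u + 3) ^ 2 * (v + 3) ^ 2)));
      [apply Z.mul_pos_pos; [reflexivity | now apply Z.mul_pos_pos] |].
    match type of HP with 0 <= ?p =>
    match type of H1 with 0 <= ?h1 =>
    match type of H2 with 0 <= ?h2 =>
    match goal with |- 0 <= ?e =>
      replace e with (Y * p + 6 * (v ^ 2 * ((u + 3) ^ 2 * ((n + x + 1) * h2)))
                      + 6 * (u ^ 2 * ((v + 3) ^ 2 * ((n - x + 1) * h1)))) by ring
    end end end end.
    repeat first [assumption | apply Z.lt_le_incl; assumption
                 | apply Z.add_nonneg_nonneg | apply Z.mul_nonneg_nonneg | discriminate].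
  - pose proof (ratio_lower_step_edge (6 * n) x u v (Hsmall ltac:(lia)) Eu Ev ltac:(lia)) as HP.
    clear Eu Ev H2 Hsmall Hlt.
    apply (Z.mul_nonneg_cancel_l (6 * (u + 3) ^ 2)); [apply Z.mul_pos_pos; [reflexivity | assumption] |].
    match type of HP with 0 <= ?p =>
    match type of H1 with 0 <= ?h1 =>
    match goal with |- 0 <= ?e =>
      replace e with (Y * p + 6 * (v ^ 2 * ((u + 3) ^ 2 * ((n + x + 1) * W)))
                      + 6 * (u ^ 2 * ((n - x + 1) * h1))) by ring
    end end end.
    repeat first [assumption | apply Z.lt_le_incl; assumption
                 | apply Z.add_nonneg_nonneg | apply Z.mul_nonneg_nonneg | discriminate].
Qed.

Lemma polya_num_ratio_lower m x :
  (3 <= m)%nat -> 0 <= x ->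
  let u := 6 * (Z.of_nat m + 2) + 2 - 9 * x in
  let v := 6 * (Z.of_nat m + 2) + 2 + 9 * x in
  0 <= u ->
  polya_num m (x - 1) * u ^ 2 <= polya_num m (x + 1) * v ^ 2.
Proof.
  intros Hm; revert x; induction Hm as [|m Hm IH]; intros x Hx u v Hu.
  - assert (x = 0 \/ x = 1 \/ x = 2 \/ x = 3) as [-> | [-> | [-> | ->]]] by lia;
      vm_compute; discriminate.
  - destruct (Z.eq_dec x 0) as [->|Hx0].
    { change (0 - 1) with (- (1)); change (0 + 1) with 1.
      rewrite polya_num_even.
      replace v with u by lia; lia. }
    (* The index is now at least 6, so [u < 15] forces [9 * x > 23]. At index 5 this would fail for
       [x = 2], where [u = 14]; that index is the base case, checked by evaluation. *)
    assert (Hsmall : u < 15 -> 3 <= x) by lia.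
    pose proof (IH (x - 1) ltac:(lia) ltac:(lia)) as H1.
    assert (H2 : 15 <= u -> _) by (intros Hbig; exact (IH (x + 1) ltac:(lia) ltac:(lia))).
    cbv zeta in H1, H2; clear IH Hm.
    cbn [polya_num].
    replace (x + 1 - 1) with x in * by ring.
    replace (x - 1 + 1) with x in * by ring.
    replace (x + 1 + 1) with (x + 2) in * by ring.
    replace (x - 1 - 1) with (x - 2) in * by ring.
    (* Lowering the index by one subtracts 6 from [u] and [v]; moving [x] by one changes them by 9
       in opposite directions. *)
    replace (6 * (Z.of_nat m + 2) + 2 - 9 * (x - 1)) with (u + 3) in H1 by lia.
    replace (6 * (Z.of_nat m + 2) + 2 + 9 * (x - 1)) with (v - 15) in H1 by lia.
    replace (6 * (Z.of_nat m + 2) + 2 - 9 * (x + 1)) with (u - 15) in H2 by lia.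
    replace (6 * (Z.of_nat m + 2) + 2 + 9 * (x + 1)) with (v + 3) in H2 by lia.
    apply (ratio_lower_combine (Z.of_nat m + 3)); try apply polya_num_nonneg; lia || assumption.
Qed.

(* Transfer to the Laplace-Pólya integrals and the final estimates *)
Close Scope Z_scope.

Lemma laplace_polya_eq n r : laplace_polya n r = / PI * polya_integral n r.
Proof. reflexivity. Qed.

(** Both sides obey the same recursion up to a factor depending on [m] alone. Since [K] does not
    depend on [z], it cancels in ratios. *)
Lemma polya_integral_proportional m :
  exists K, 0 < K /\ forall z, polya_integral (m + 2) (IZR z) = K * IZR (polya_num m z).
Proof.
  induction m as [|m [K [HK IH]]].
  - exists (polya_integral 2 0 / 2); split; [pose proof polya_integral_2_0_pos; lra|].
    intros z; cbn [Nat.add polya_num].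
    rewrite polya_integral_2.
    enough (E : Rabs (IZR z + 2) + Rabs (IZR z - 2) - 2 * Rabs (IZR z)
                = 2 * IZR (Z.max 0 (2 - Z.abs z))) by nra.
    rewrite <- plus_IZR, <- minus_IZR, <- !abs_IZR, <- !mult_IZR, <- plus_IZR, <- minus_IZR.
    f_equal; lia.
  - exists (K / (2 * INR (m + 2))).
    assert (Hn : 0 < INR (m + 2)) by (apply lt_0_INR; lia).
    split; [apply Rdiv_lt_0_compat; lra|].
    intros z; cbn [Nat.add polya_num].
    apply (Rmult_eq_reg_l (INR (m + 2))); [|lra].
    rewrite polya_integral_rec by lia.
    rewrite <- plus_IZR, <- minus_IZR, !IH, plus_IZR, !mult_IZR, minus_IZR, !plus_IZR.
    rewrite <- INR_IZR_INZ, S_INR, plus_INR in *; simpl (INR 2) in *.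
    field; lra.
Qed.

Lemma laplace_polya_0_pos n : (2 <= n)%nat -> 0 < laplace_polya n 0.
Proof.
  intros Hn; rewrite laplace_polya_eq.
  destruct (polya_integral_proportional (n - 2)) as [K [HK H]].
  replace (n - 2 + 2)%nat with n in H by lia.
  rewrite (H 0%Z).
  apply Rmult_lt_0_compat; [apply Rinv_0_lt_compat, PI_RGT_0|].
  apply Rmult_lt_0_compat; [exact HK|].
  apply (IZR_lt 0), polya_num_pos; lia.
Qed.

Lemma laplace_polya_ratio_2_0 m :
  laplace_polya (m + 2) 2 / laplace_polya (m + 2) 0
  = IZR (polya_num m 2) / IZR (polya_num m 0).
Proof.
  rewrite !laplace_polya_eq.
  destruct (polya_integral_proportional m) as [K [HK H]].
  rewrite (H 2%Z), (H 0%Z).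
  assert (0 < IZR (polya_num m 0)) by (apply (IZR_lt 0), polya_num_pos; lia).
  pose proof PI_RGT_0; field; lra.
Qed.

(** At [r = 0] evenness merges the two terms of the recursion into the value at [1]; a second step
    at [r = 1] leads to the values at [2] and [0]. The result is increasing in their ratio. *)
Lemma laplace_polya_ratio_center n : (2 <= n)%nat ->
  laplace_polya (n + 2) 0 / laplace_polya n 0
  = (INR n + 2) / (INR n + 1)
    * ((INR n + 2) / (2 * INR n) * (laplace_polya n 2 / laplace_polya n 0) + 1 / 2).
Proof.
  intros Hn.
  pose proof (laplace_polya_0_pos n Hn) as Hpos.
  rewrite !laplace_polya_eq in *.
  pose proof PI_RGT_0 as HPI.
  assert (Hn0 : 2 <= INR n) by (apply (le_INR 2); exact Hn).
  assert (E1 := polya_integral_rec (S n) 0 ltac:(lia)).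
  assert (E2 := polya_integral_rec n 1 Hn).
  rewrite Rplus_0_l, Rminus_0_l, polya_integral_even in E1.
  rewrite Rminus_diag in E2.
  replace (1 + 1) with 2 in E2 by ring.
  replace (n + 2)%nat with (S (S n)) by lia.
  rewrite !S_INR in *.
  assert (HI : polya_integral n 0 <> 0).
  { intros E; rewrite E, Rmult_0_r in Hpos; lra. }
  assert (E3 : polya_integral (S (S n)) 0
    = (INR n + 2) / (INR n + 1) * ((INR n + 2) / 2 * polya_integral n 2
         + INR n / 2 * polya_integral n 0) / INR n).
  { apply (Rmult_eq_reg_l (INR n * (INR n + 1))); [|nra].
    transitivity ((INR n + 2) * ((INR n + 2) / 2 * polya_integral n 2
         + INR n / 2 * polya_integral n 0)); [|field; lra].
    nra. }
  rewrite E3; field; repeat split; lra.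
Qed.

Lemma laplace_polya_ratio_2_0_upper n : (4 <= n)%nat ->
  laplace_polya n 2 / laplace_polya n 0 <= (INR n - 2) / (INR n + 4).
Proof.
  intros Hn.
  replace n with ((n - 2) + 2)%nat at 1 2 by lia.
  rewrite laplace_polya_ratio_2_0.
  (* At [x = 1] the common factor [n * (n + 2)] cancels, leaving [(n - 2) / (n + 4)]. *)
  assert (H := polya_num_ratio_upper (n - 2) 1 ltac:(lia) ltac:(lia)).
  cbv zeta in H.
  replace (Z.of_nat (n - 2) + 2)%Z with (Z.of_nat n) in H by lia.
  change (1 + 1)%Z with 2%Z in H; change (1 - 1)%Z with 0%Z in H.
  assert (0 < IZR (polya_num (n - 2) 0)) by (apply (IZR_lt 0), polya_num_pos; lia).
  assert (Hn0 : 4 <= INR n) by (apply (le_INR 4) in Hn; simpl in Hn; lra).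
  apply IZR_le in H.
  rewrite !mult_IZR, !plus_IZR, !minus_IZR, !plus_IZR, <- !INR_IZR_INZ in H.
  apply Rle_div_l; [assumption|].
  apply (Rmult_le_reg_r (INR n * (INR n + 2) * (INR n + 4))).
  { repeat apply Rmult_lt_0_compat; lra. }
  replace ((INR n - 2) / (INR n + 4) * IZR (polya_num (n - 2) 0)
           * (INR n * (INR n + 2) * (INR n + 4)))
    with (IZR (polya_num (n - 2) 0) * ((INR n - 2) * INR n * (INR n + 2))) by (field; lra).
  lra.
Qed.

(** The inductive bound at [x = 1] covers [n >= 5]; direct evaluation gives the ratios [1/6] and
    [1/4] for [n = 3] and [n = 4]. The case [n = 3] serves the estimate for central values. *)
Lemma laplace_polya_ratio_2_0_lower n : (3 <= n)%nat ->
  INR n * (INR n - 2) / (INR n + 2) ^ 2 < laplace_polya n 2 / laplace_polya n 0.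
Proof.
  intros Hn.
  destruct (le_lt_dec 5 n) as [Hn5|Hn5].
  - replace n with ((n - 2) + 2)%nat at 4 5 by lia.
    rewrite laplace_polya_ratio_2_0.
    assert (H := polya_num_ratio_lower (n - 2) 1 ltac:(lia) ltac:(lia)).
    cbv zeta in H; specialize (H ltac:(lia)).
    replace (Z.of_nat (n - 2) + 2)%Z with (Z.of_nat n) in H by lia.
    change (1 + 1)%Z with 2%Z in H; change (1 - 1)%Z with 0%Z in H.
    assert (HB : 0 < IZR (polya_num (n - 2) 0)) by (apply (IZR_lt 0), polya_num_pos; lia).
    assert (Hn0 : 5 <= INR n) by (apply (le_INR 5) in Hn5; simpl in Hn5; lra).
    apply IZR_le in H.
    rewrite !Z.pow_2_r, !mult_IZR, !minus_IZR, !plus_IZR, !mult_IZR, <- !INR_IZR_INZ in H.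
    set (B := IZR (polya_num (n - 2) 0)) in *; set (A := IZR (polya_num (n - 2) 2)) in *.
    set (N := INR n) in *; clearbody A B N.
    apply (proj1 (Rlt_div_r (N * (N - 2) / (N + 2) ^ 2) A B HB)).
    apply (Rmult_lt_reg_r ((N + 2) ^ 2 * (6 * N + 11) ^ 2)); [apply Rmult_lt_0_compat; nra|].
    replace (N * (N - 2) / (N + 2) ^ 2 * B * ((N + 2) ^ 2 * (6 * N + 11) ^ 2))
      with (B * (N * (N - 2) * (6 * N + 11) ^ 2)) by (field; lra).
    apply Rlt_le_trans with (B * ((6 * N - 7) ^ 2 * (N + 2) ^ 2)).
    (* The terms of degree four, three and two agree: [(6 * N - 7) ^ 2 * (N + 2) ^ 2] exceeds
       [N * (N - 2) * (6 * N + 11) ^ 2] by [102 * N + 196]. *)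
    + apply Rmult_lt_compat_l; [exact HB|nra].
    + replace (B * ((6 * N - 7) ^ 2 * (N + 2) ^ 2))
        with ((N + 2) ^ 2 * (B * ((6 * N + 2 - 9 * 1) * (6 * N + 2 - 9 * 1)))) by ring.
      replace (A * ((N + 2) ^ 2 * (6 * N + 11) ^ 2))
        with ((N + 2) ^ 2 * (A * ((6 * N + 2 + 9 * 1) * (6 * N + 2 + 9 * 1)))) by ring.
      apply Rmult_le_compat_l; [apply pow2_ge_0|exact H].
  - assert (n = 3 \/ n = 4)%nat as [-> | ->] by lia.
    + pose proof (laplace_polya_ratio_2_0 1) as E; cbn [Nat.add] in E; rewrite E; clear E.
      cbn -[IZR]; lra.
    + pose proof (laplace_polya_ratio_2_0 2) as E; cbn [Nat.add] in E; rewrite E; clear E.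
      cbn -[IZR]; lra.
Qed.

Theorem corollary1p3 :
  (forall n : nat, (4 <= n)%nat ->
     INR n * (INR n - 2) / (INR n + 2) ^ 2
       < laplace_polya n 2 / laplace_polya n 0
     /\ laplace_polya n 2 / laplace_polya n 0
       <= (INR n - 2) / (INR n + 4))
  /\
  (forall n : nat, (2 <= n)%nat ->
     INR n / (INR n + 1) <= laplace_polya (n + 2) 0 / laplace_polya n 0
     /\ ((3 <= n)%nat ->
           INR n / (INR n + 1) < laplace_polya (n + 2) 0 / laplace_polya n 0))
  /\
  (forall n : nat, (4 <= n)%nat ->
     laplace_polya (n + 2) 0 / laplace_polya n 0
       <= (INR n + 2) * (INR n ^ 2 + 2 * INR n - 2)
          / (INR n * (INR n + 1) * (INR n + 4))).
Proof.
  split; [|split].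
  - intros n Hn; split.
    + apply laplace_polya_ratio_2_0_lower; lia.
    + now apply laplace_polya_ratio_2_0_upper.
  - assert (Hlow : forall n, (3 <= n)%nat ->
      INR n / (INR n + 1) < laplace_polya (n + 2) 0 / laplace_polya n 0).
    { intros n Hn.
      rewrite laplace_polya_ratio_center by lia.
      pose proof (laplace_polya_ratio_2_0_lower n Hn) as H.
      assert (Hn0 : 2 <= INR n) by (apply (le_INR 2); lia).
      set (q := laplace_polya n 2 / laplace_polya n 0) in *; clearbody q.
      replace (INR n / (INR n + 1)) with
        ((INR n + 2) / (INR n + 1)
         * ((INR n + 2) / (2 * INR n) * (INR n * (INR n - 2) / (INR n + 2) ^ 2) + 1 / 2))
        by (field; lra).
      apply Rmult_lt_compat_l; [apply Rdiv_lt_0_compat; lra|].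
      apply Rplus_lt_compat_r, Rmult_lt_compat_l; [apply Rdiv_lt_0_compat; lra|exact H]. }
    intros n Hn; split; [|apply Hlow].
    (* At [n = 2] the value at [r = 2] is zero and the central ratio is exactly [2 / 3], so the
       bound is attained and only the weak inequality holds. *)
    destruct (Nat.eq_dec n 2) as [->|Hn2].
    + rewrite laplace_polya_ratio_center by lia.
      pose proof (laplace_polya_ratio_2_0 0) as E; cbn [Nat.add] in E; rewrite E; clear E.
      cbn -[IZR]; lra.
    + apply Rlt_le, Hlow; lia.
  - intros n Hn.
    rewrite laplace_polya_ratio_center by lia.
    pose proof (laplace_polya_ratio_2_0_upper n Hn) as H.
    assert (Hn0 : 2 <= INR n) by (apply (le_INR 2); lia).
    set (q := laplace_polya n 2 / laplace_polya n 0) in *; clearbody q.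
    replace ((INR n + 2) * (INR n ^ 2 + 2 * INR n - 2) / (INR n * (INR n + 1) * (INR n + 4))) with
      ((INR n + 2) / (INR n + 1)
       * ((INR n + 2) / (2 * INR n) * ((INR n - 2) / (INR n + 4)) + 1 / 2))
      by (field; lra).
    apply Rmult_le_compat_l; [apply Rlt_le, Rdiv_lt_0_compat; lra|].
    apply Rplus_le_compat_r, Rmult_le_compat_l; [apply Rlt_le, Rdiv_lt_0_compat; lra|exact H].
Qed.
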